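(* There is a non-separable Urysohn space $X$ of countable $\pi$-character such that $(\mathfrak{c},\omega)$ is a dominating pair for $X$.
   Context: $\mathfrak{c} = 2^\omega$. For cardinals $\kappa > \lambda \ge \omega$, $(\kappa,\lambda)$ is a dominating pair for a topological space $X$ if for every $A \subset X$ with $|A| \le \kappa$ there is $B \subset X$ with $|B| \le \lambda$ such that $A \subset \overline{B}$. A space is Urysohn if any two distinct points have neighborhoods with disjoint closures. $X$ has countable $\pi$-character if every point $x \in X$ has a countable local $\pi$-base, i.e. a countable family of non-empty open sets such that every neighborhood of $x$ includes a member of the family. *)

(* Defs.v *)
From mathcomp Require Import all_boot.
From mathcomp Require Import boolp classical_sets functions cardinality filter.
From mathcomp Require Import topology.

Set Implicit Arguments.
Unset Strict Implicit.
Unset Printing Implicit Defensive.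

Local Open Scope classical_set_scope.
Local Open Scope card_scope.

(* "Countable" means of cardinality at most omega; finite sets are allowed. *)
Definition separable (X : topologicalType) : Prop :=
  exists2 D : set X, countable D & dense D.

(* Neighborhoods are not required to be open. *)
Definition urysohn_space (X : topologicalType) : Prop :=
  forall x y : X, x <> y ->
    exists U V : set X,
      [/\ nbhs x U, nbhs y V & closure U `&` closure V = set0].

(* The point x itself need not belong to the members of a local pi-base. *)
Definition local_pi_base (X : topologicalType) (x : X) (F : set (set X)) :
    Prop :=
  (forall U, F U -> open U /\ U !=set0) /\
  (forall N, nbhs x N -> exists2 U, F U & U `<=` N).

Definition countable_pi_character (X : topologicalType) : Prop :=
  forall x : X, exists2 F : set (set X), countable F & local_pi_base x F.

(* A cardinal is represented by a type of that cardinality; the first three   *)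
(* clauses express kappa > lambda >= omega.                                   *)
Definition dominating_pair (kappa lambda : Type) (X : topologicalType) :
    Prop :=
  [/\ [set: nat] #<= [set: lambda],
      [set: lambda] #<= [set: kappa],
      ~ ([set: kappa] #<= [set: lambda])
    & forall A : set X, A #<= [set: kappa] ->
        exists2 B : set X, B #<= [set: lambda] & A `<=` closure B].

(* 2^omega *)
Definition continuum : Type := nat -> bool.

(* Main.v *)
Require Import Defs.
From HB Require Import structures.
From mathcomp Require Import all_boot.
From mathcomp Require Import boolp classical_sets functions cardinality filter.
From mathcomp Require Import topology.

(** Let L be a countable set carrying, for every [p] in 2^c, a free proper
filter F_p, the F_p being the traces on L of the points of the Cantor cube 2^c,
in which L is dense. Preorder 2^c by a relation [<=] for which every family of at
most c elements is bounded while no countable family is cofinal. Points are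
pairs (finite word over L, element of 2^c); a set is open if, with [(s, p)], it
contains the cones [{(t, q) | t extends s i, p <= q}] for all [i] in some member
of F_p. These cones form a countable local pi-base at [(s, p)]. If [g] bounds the
second components of the points of A, then A lies in the closure of the countable
set of all [(s, g)], whereas non-cofinality of countable families excludes
separability. Distinct points are separated by clopen sets: by their words or,
if the words agree, by disjoint members of the filters F_p. *)

Set Implicit Arguments.
Unset Strict Implicit.
Unset Printing Implicit Defensive.

Local Open Scope classical_set_scope.
Local Open Scope card_scope.

(** * Diagonalization and coding on the continuum *)

Lemma cantor_diagonal (T : Type) (f : T -> T -> bool) :
  exists t : T -> bool, forall x, f x <> t.
Proof.
exists (fun x => ~~ f x x) => x /(congr1 (fun h => h x)).
by case: (f x x).
Qed.

Definition interleave (x y : continuum) : continuum :=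
  fun n => if odd n then y n./2 else x n./2.

Definition evens (z : continuum) : continuum := fun n => z n.*2.

Definition odds (z : continuum) : continuum := fun n => z n.*2.+1.

Lemma interleaveK1 x y : evens (interleave x y) = x.
Proof. by apply/funext => n; rewrite /evens /interleave odd_double doubleK. Qed.

Lemma interleaveK2 x y : odds (interleave x y) = y.
Proof.
by apply/funext => n; rewrite /odds /interleave /= odd_double /= uphalf_double.
Qed.

Lemma nat_le_continuum : [set: nat] #<= [set: continuum].
Proof.
apply/pcard_injP; exists (fun m n => m == n) => m n _ _.
by move=> /(congr1 (fun h => h n)); rewrite eqxx => /eqP.
Qed.

Lemma continuum_not_le_nat : ~ ([set: continuum] #<= [set: nat]).
Proof.
move=> /pcard_injP[f f_inj].
pose g n := xget (fun=> false) [set z : continuum | f z = n].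
have [t /(_ (f t))] := cantor_diagonal g; apply.
apply: f_inj; rewrite ?inE//.
by apply: (@xgetPex _ _ [set z : continuum | f z = f t]); exists t.
Qed.

(** * The preorder on the Cantor cube *)

(* [p] encodes the family of its rows, indexed by the continuum. *)
Definition row (p : continuum -> bool) (x : continuum) : continuum -> bool :=
  fun y => p (interleave x y).

Definition row_le (p q : continuum -> bool) : Prop :=
  range (row p) `<=` range (row q).

Lemma row_le_refl p : row_le p p.
Proof. by []. Qed.

Lemma row_le_trans q p r : row_le p q -> row_le q r -> row_le p r.
Proof. exact: subset_trans. Qed.

(** Pairing the code [c x] with a row index [y] packs the rows of all the [f x] into one family that
    is still indexed by the continuum. *)
Lemma row_le_bounded (T : choiceType) (f : T -> continuum -> bool) (A : set T) :
  A #<= [set: continuum] -> exists g, forall x, A x -> row_le (f x) g.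
Proof.
move=> /pcard_injP[c c_inj].
have [[x0 _]|A0] := pselect (A !=set0); last first.
  by exists (fun=> false) => x Ax; case: A0; exists x.
pose d z := xget x0 [set x | A x /\ c x = z].
exists (fun z => row (f (d (evens (evens z)))) (odds (evens z)) (odds z)).
move=> x Ax _ [y _ <-]; exists (interleave (c x) y) => //.
apply/funext => z; rewrite /row !(interleaveK1, interleaveK2).
suff -> : d (c x) = x by [].
have [|Ad cd] := @xgetPex _ x0 [set x' | A x' /\ c x' = c x]; first by exists x.
by apply: c_inj cd; rewrite inE.
Qed.

(** All rows of the witness equal one function, which diagonalizes against the rows of [g]. *)
Lemma row_le_not_top g : exists p, ~ row_le p g.
Proof.
have [t tg] := cantor_diagonal (row g).
exists (fun z => t (odds z)) => pg.
have [|y _] := pg t; last exact: tg.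
exists (fun=> false) => //; apply/funext => z.
by rewrite /row interleaveK2.
Qed.

(** * Letters and their filters *)

(* A letter [(n, a)] is the continuous function on the Cantor set that is the *)
(* indicator of the set [a] of cylinders of length [n].                       *)
Definition letter : Type := (nat * seq (seq bool))%type.

HB.instance Definition _ := Countable.on letter.

Definition letter_fun (i : letter) (z : continuum) : bool :=
  mkseq z i.1 \in i.2.

(* The basic sets of the filter F_p. *)
Definition agree (p : continuum -> bool) (N : nat) (l : seq continuum) :
    set letter :=
  [set i | (N <= i.1)%N /\ {in l, letter_fun i =1 p}].

(** Long enough initial segments tell the finitely many points of [l] apart, so a letter can
    prescribe arbitrary values on [l]. *)
Lemma agree_nonempty p N l : agree p N l !=set0.
Proof.
(* A position where [z] and [w] differ; the default 0 occurs only for equal points. *)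
pose diff (z w : continuum) := xget 0 [set k | z k <> w k].
(* The successor puts position [diff z w] inside the segments of length [M]. *)
pose M := maxn N (\max_(z <- l) \max_(w <- l) (diff z w).+1).
exists (M, [seq mkseq z M | z <- l & p z]); split; first exact: leq_maxl.
move=> z zl; rewrite /letter_fun /=; apply/mapP/idP => [[w]|pz]; last first.
  by exists z; rewrite // mem_filter pz.
rewrite mem_filter => /andP[pw wl] zw.
suff -> : z = w by [].
apply: contrapT => zNw.
have : [set k | z k <> w k] (diff z w).
  by apply: xgetPex; apply: contrapT => /forallNP zEw; apply: zNw;
     apply/funext => k; apply: contrapT; apply: zEw.
apply => /=.
have ltM : (diff z w < M)%N.
  rewrite /M leq_max; apply/orP; right.
  apply: leq_trans (leq_bigmax_seq _ zl erefl).
  exact: leq_bigmax_seq wl erefl.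
by rewrite -(nth_mkseq false z ltM) zw nth_mkseq.
Qed.

(** * The topology on words with a point of the cube *)

Definition space : Type := (seq letter * (continuum -> bool))%type.

HB.instance Definition _ := Choice.on space.

Definition cone (s : seq letter) (p : continuum -> bool) : set space :=
  [set x | prefix s x.1 /\ row_le p x.2].

Lemma cone_rcons_sub s i p q : row_le p q -> cone (rcons s i) q `<=` cone s p.
Proof.
move=> pq x [sx qx]; split; last exact: row_le_trans qx.
by apply: prefix_trans sx; exact: prefix_rcons.
Qed.

Definition space_open (U : set space) : Prop :=
  forall s p, U (s, p) ->
    exists N l, forall i, agree p N l i -> cone (rcons s i) p `<=` U.

Lemma space_openT : space_open setT.
Proof. by move=> s p _; exists 0, [::]. Qed.

Lemma space_openI : setI_closed space_open.
Proof.
move=> U V oU oV s p [/oU[N [l UN]] /oV[M [k VM]]].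
exists (maxn N M), (l ++ k) => i [Ni li] x xi; split.
- apply: UN xi; split=> [|z zl]; first exact: leq_trans (leq_maxl _ _) Ni.
  by apply: li; rewrite mem_cat zl.
- apply: VM xi; split=> [|z zk]; first exact: leq_trans (leq_maxr _ _) Ni.
  by apply: li; rewrite mem_cat zk orbT.
Qed.

Lemma space_open_bigU (I : Type) (f : I -> set space) :
  (forall i, space_open (f i)) -> space_open (\bigcup_i f i).
Proof.
move=> of_ s p [j _ /of_[N [l fN]]]; exists N, l => i /fN fi x /fi.
by exists j.
Qed.

HB.instance Definition _ := isOpenTopological.Build space
  space_openT space_openI space_open_bigU.

Lemma open_cone s p : open (cone s p).
Proof.
move=> t q [/= st pq]; exists 0, [::] => i _ x /(cone_rcons_sub (@row_le_refl q)).
move=> [tx qx]; split; first exact: prefix_trans tx.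
exact: row_le_trans qx.
Qed.

Lemma cone_nonempty s p : cone s p !=set0.
Proof. by exists (s, p); split; [exact: prefix_refl|exact: row_le_refl]. Qed.

Lemma nbhs_cone (s : seq letter) p (U : set space) :
  nbhs ((s, p) : space) U -> exists i, cone (rcons s i) p `<=` U.
Proof.
rewrite nbhsE => -[V [oV Vsp] VU].
have [N [l Vi]] := oV _ _ Vsp.
have [i /Vi iV] := agree_nonempty p N l.
by exists i; exact: subset_trans VU.
Qed.

(** * Clopen sets and separation *)

Definition extensions (s : seq letter) : set space := [set x | prefix s x.1].

Lemma open_extensions s : open (extensions s).
Proof.
move=> t q /= st; exists 0, [::] => i _ x [tx _].
apply: prefix_trans tx; apply: prefix_trans st _; exact: prefix_rcons.
Qed.

Lemma prefix_comparable (T : eqType) (s t u : seq T) :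
  prefix s u -> prefix t u -> size s <= size t -> prefix s t.
Proof.
rewrite !prefixE => /eqP us /eqP ut st.
by rewrite -ut -take_min (minn_idPl st) us.
Qed.

Lemma open_extensionsC s : open (~` extensions s).
Proof.
(* This bound exceeds the length of every letter of [s], so the new letter [i] is not in [s] and
   [rcons t i] cannot be a prefix of [s]. *)
move=> t q Nst; exists (\max_(i <- s) i.1).+1, [::] => i [iN _] x [tx _] sx.
have : ~~ prefix (rcons t i) s.
  apply/negP => /prefixP[u su]; have : i \in s.
    by rewrite su mem_cat mem_rcons mem_head.
  move=> /(@leq_bigmax_seq _ _ xpredT (fun j : letter => j.1)) /(_ erefl).
  by rewrite leqNgt iN.
have [szs|szs] := leqP (size s) (size t).
  case: Nst; apply: (prefix_comparable sx) szs.
  by apply: prefix_trans tx; exact: prefix_rcons.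
by move/negP; apply; apply: (prefix_comparable tx sx); rewrite size_rcons.
Qed.

(* The second component of a point also serves as the value at the end of its *)
(* word, where no letter is left to be read.                                  *)
Definition value_after (s : seq letter) (z : continuum) (x : space) : bool :=
  if drop (size s) x.1 is i :: _ then letter_fun i z else x.2 z.

Definition branch (s : seq letter) (z : continuum) (b : bool) : set space :=
  [set x | prefix s x.1 /\ value_after s z x = b].

Lemma open_branch s z b : open (branch s z b).
Proof.
move=> _ q [/= /prefixP[u ->]].
rewrite /value_after /= drop_size_cat// => ub.
(* If the word is [s] itself, agreement at [z] gives the new letter the value [q z] there; if it is
   longer, the letter read after [s] does not change. *)
exists 0, [:: z] => i [_ iz] [_ r] [/= /prefixP[v ->] _].
rewrite -cats1 -!catA; split; first exact: prefix_prefix.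
rewrite /value_after drop_size_cat//.
by case: u ub => [|j u] //= <-; apply: iz; rewrite mem_head.
Qed.

Lemma branchC s z b : ~` branch s z b = ~` extensions s `|` branch s z (~~ b).
Proof.
apply/seteqP; split=> [x Nx|x [Nx [sx _]|[_ xb] [_]]].
- have [sx|Nsx] := pselect (prefix s x.1); last by left.
  right; split=> //; case: (value_after s z x =P b) => [xb|/eqP].
    by case: Nx.
  by rewrite -addbN; case: (value_after _ _ _) b {Nx} => -[].
- exact: Nx.
- by rewrite xb; case: b {xb}.
Qed.

Lemma open_branchC s z b : open (~` branch s z b).
Proof.
by rewrite branchC; apply: openU; [exact: open_extensionsC|exact: open_branch].
Qed.

Lemma space_clopen_separated (x y : space) : x <> y ->
  exists U : set space, [/\ open U, open (~` U), U x & ~ U y].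
Proof.
case: x y => [s p] [t q] xy.
have [st|Nst] := boolP (prefix s t); last first.
  exists (extensions s); split; [exact: open_extensions
    |exact: open_extensionsC|exact: prefix_refl|exact/negP].
have [ts|Nts] := boolP (prefix t s); last first.
  exists (~` extensions t); rewrite setCK; split; [exact: open_extensionsC
    |exact: open_extensions|exact/negP|apply; exact: prefix_refl].
have ? : s = t.
  by move: ts; rewrite prefixE take_oversize ?size_prefix// => /eqP.
subst t.
have [z pqz] : exists z, p z <> q z.
  apply: contrapT => /forallNP pq; apply: xy; congr (_, _).
  by apply/funext => z; apply: contrapT; exact: pq.
exists (branch s z (p z)); split; [exact: open_branch|exact: open_branchC| |].
  by split; [exact: prefix_refl|rewrite /value_after drop_size].
by move=> [_]; rewrite /value_after drop_size => /esym.
Qed.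

Lemma urysohn_of_clopen_separated (X : topologicalType) :
  (forall x y : X, x <> y ->
    exists U : set X, [/\ open U, open (~` U), U x & ~ U y]) ->
  urysohn_space X.
Proof.
move=> sep x y /sep[U [oU oCU Ux NUy]]; exists U, (~` U); split.
- exact: open_nbhs_nbhs.
- exact: open_nbhs_nbhs.
- have cU : closed U by rewrite -[U]setCK; exact: open_closedC.
  have cCU : closed (~` U) by exact: open_closedC.
  by rewrite -(closure_id U).1// -(closure_id (~` U)).1// setICr.
Qed.

(** * Verification of the cardinal properties *)

Lemma space_countable_pi_character : countable_pi_character space.
Proof.
move=> [s p]; exists (range (fun i => cone (rcons s i) p)).
  by apply: card_le_trans (card_image_le _ _) _; exact: countableP.
split=> [_ [i _ <-]|N /nbhs_cone[i iN]].
  by split; [exact: open_cone|exact: cone_nonempty].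
by exists (cone (rcons s i) p) => //; exists i.
Qed.

(** A bound [g] for the second components of a countable dense set would lie above every [p], since
    the open cone at [([::], p)] meets that set. *)
Lemma space_not_separable : ~ separable space.
Proof.
move=> [D Dc Dd].
have [g Dg] := row_le_bounded snd (card_le_trans Dc nat_le_continuum).
have [p Npg] := row_le_not_top g.
have [x [[_ px] Dx]] := Dd _ (cone_nonempty [::] p) (@open_cone [::] p).
exact/Npg/(row_le_trans px)/Dg.
Qed.

Lemma space_dominating_pair : dominating_pair continuum nat space.
Proof.
split; [exact: card_lexx|exact: nat_le_continuum|exact: continuum_not_le_nat|].
move=> A /(row_le_bounded snd)[g Ag].
exists (range (fun s : seq letter => (s, g) : space)).
  by apply: card_le_trans (card_image_le _ _) _; exact: countableP.
move=> [s p] Asp U /nbhs_cone[i iU].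
exists (rcons s i, g); split; first by exists (rcons s i).
by apply: iU; split; [exact: prefix_refl|exact: Ag Asp].
Qed.

Theorem mainTheorem8 :
  exists X : topologicalType,
    [/\ ~ separable X,
        urysohn_space X,
        countable_pi_character X
      & dominating_pair continuum nat X].
Proof.
exists space; split.
- exact: space_not_separable.
- exact: urysohn_of_clopen_separated space_clopen_separated.
- exact: space_countable_pi_character.
- exact: space_dominating_pair.
Qed.
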